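(* Let $k\ge 2$ and $1\le i\le k$ be integers. Then, with the convention $N_k=0$, $$\sum_{N_1\ge N_2\ge\cdots\ge N_{k-1}\ge 0}\frac{q^{\frac{(N_1+1)N_1}{2}+N_2^2+\cdots+N_{k-1}^2+N_{i+1}+\cdots+N_{k-1}}\,(-q)_{N_1-1}\,(1+q^{N_i})}{(q)_{N_1-N_2}\cdots(q)_{N_{k-2}-N_{k-1}}(q)_{N_{k-1}}}=\frac{(-q)_\infty\,(q^i,q^{2k-i},q^{2k};q^{2k})_\infty}{(q)_\infty}.$$
   Context: Notation: $(a;q)_\infty=\prod_{j\ge0}(1-aq^j)$, $(a)_\infty=(a;q)_\infty$, $(a_1,\ldots,a_r;q)_\infty=\prod_{l=1}^r(a_l;q)_\infty$, and $(a)_n=(a;q)_n=(a)_\infty/(aq^n)_\infty$ for all integers $n$; so $(q)_n=\prod_{j=1}^n(1-q^j)$, $(-q)_n=\prod_{j=1}^n(1+q^j)$ for $n\ge0$, and $(-q)_{-1}=1/2$. The sum $N_{i+1}+\cdots+N_{k-1}$ is $0$ when $i\ge k-1$. The denominator on the left is $\big(\prod_{r=1}^{k-2}(q)_{N_r-N_{r+1}}\big)(q)_{N_{k-1}}$. The identity is one of formal power series in $q$. *)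

(* Defs.v *)
From HB Require Import structures.
From mathcomp Require Import all_boot all_order all_algebra.
From mathcomp Require Import boolp classical_sets cardinality fsbigop.

Set Implicit Arguments.
Unset Strict Implicit.
Unset Printing Implicit Defensive.

Import Order.TTheory GRing.Theory Num.Theory.
Local Open Scope ring_scope.

(* Formal power series: [x n] is the coefficient of q^n in [x].  A record and
   not a bare function, since functions carry a pointwise product. *)
Record fps (R : Type) := FPS { fps_coef :> nat -> R }.

HB.instance Definition _ (R : Type) := gen_eqMixin (fps R).
HB.instance Definition _ (R : Type) := gen_choiceMixin (fps R).

Lemma fpsP (R : Type) (x y : fps R) : x =1 y -> x = y.
Proof. by case: x y => [x] [y] /= /funext ->. Qed.

Section FpsRing.
Variable R : comNzRingType.
Implicit Types x y z : fps R.

Definition fps_zero : fps R := FPS (fun=> 0).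
Definition fps_opp x : fps R := FPS (fun n => - x n).
Definition fps_add x y : fps R := FPS (fun n => x n + y n).
Definition fps_one : fps R := FPS (fun n => (n == 0%N)%:R).
Definition fps_mul x y : fps R :=
  FPS (fun n => \sum_(i < n.+1) x i * y (n - i)%N).

Fact fps_addA : associative fps_add.
Proof. by move=> x y z; apply: fpsP => n /=; rewrite addrA. Qed.
Fact fps_addC : commutative fps_add.
Proof. by move=> x y; apply: fpsP => n /=; rewrite addrC. Qed.
Fact fps_add0 : left_id fps_zero fps_add.
Proof. by move=> x; apply: fpsP => n /=; rewrite add0r. Qed.
Fact fps_addN : left_inverse fps_zero fps_opp fps_add.
Proof. by move=> x; apply: fpsP => n /=; rewrite addNr. Qed.

HB.instance Definition _ := GRing.isZmodule.Build (fps R)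
  fps_addA fps_addC fps_add0 fps_addN.

Let trunc m x : {poly R} := \poly_(i < m) x i.

Let coef_trunc m x n : (n < m)%N -> (trunc m x)`_n = x n.
Proof. by move=> ltnm; rewrite coef_poly ltnm. Qed.

Let mulE m x y n : (n < m)%N -> fps_mul x y n = (trunc m x * trunc m y)`_n.
Proof.
move=> ltnm; rewrite coefM; apply: eq_bigr => i _.
have ltim : (i < m)%N by apply: leq_ltn_trans ltnm; rewrite -ltnS.
by rewrite !coef_trunc // (leq_ltn_trans (leq_subr i n) ltnm).
Qed.

Fact fps_mulA : associative fps_mul.
Proof.
move=> x y z; apply: fpsP => n.
transitivity ((trunc n.+1 x * (trunc n.+1 y * trunc n.+1 z))`_n).
  rewrite coefM; apply: eq_bigr => i _.
  by rewrite coef_trunc // -(@mulE n.+1) // ltnS leq_subr.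
rewrite mulrA coefM; apply: eq_bigr => i _.
by rewrite -(@mulE n.+1) // coef_trunc // ltnS leq_subr.
Qed.
Fact fps_mulC : commutative fps_mul.
Proof. by move=> x y; apply: fpsP => n; rewrite !(@mulE n.+1) // mulrC. Qed.
Fact fps_mul1 : left_id fps_one fps_mul.
Proof.
move=> x; apply: fpsP => n /=.
by rewrite big_ord_recl /= mul1r subn0 big1 ?addr0 // => i _; rewrite mul0r.
Qed.
Fact fps_mulDl : left_distributive fps_mul fps_add.
Proof.
move=> x y z; apply: fpsP => n /=.
by rewrite -big_split; apply: eq_bigr => i _ /=; rewrite mulrDl.
Qed.
Fact fps_oner_neq0 : fps_one != 0 :> fps R.
Proof.
by apply/eqP => /(congr1 (fun x : fps R => x 0%N)) /eqP /=; rewrite oner_eq0.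
Qed.

HB.instance Definition _ := GRing.Zmodule_isComNzRing.Build (fps R)
  fps_mulA fps_mulC fps_mul1 fps_mulDl fps_oner_neq0.

Lemma coef0_fps n : (0 : fps R) n = 0. Proof. by []. Qed.
Lemma coef1_fps n : (1 : fps R) n = (n == 0%N)%:R. Proof. by []. Qed.
Lemma coefN_fps x n : (- x) n = - x n. Proof. by []. Qed.
Lemma coefD_fps x y n : (x + y) n = x n + y n. Proof. by []. Qed.
Lemma coefM_fps x y n : (x * y) n = \sum_(i < n.+1) x i * y (n - i)%N.
Proof. by []. Qed.

Definition fps_unit : pred (fps R) := fun x => `[< exists y, y * x = 1 >].
Definition fps_inv x : fps R :=
  if pselect (exists y, y * x = 1) is left e then projT1 (cid e) else x.

Fact fps_mulVx : {in fps_unit, left_inverse 1 fps_inv *%R}.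
Proof.
move=> x /asboolP ux; rewrite /fps_inv; case: pselect => // e.
by case: (cid e).
Qed.
Fact fps_unitPl x y : y * x = 1 -> fps_unit x.
Proof. by move=> yx1; apply/asboolP; exists y. Qed.
Fact fps_inv_out : {in [predC fps_unit], fps_inv =1 id}.
Proof.
by move=> x; rewrite inE => /asboolP nux; rewrite /fps_inv; case: pselect.
Qed.

HB.instance Definition _ := GRing.ComNzRing_hasMulInverse.Build (fps R)
  fps_mulVx fps_unitPl fps_inv_out.

End FpsRing.

Section FpsLimits.
Variable R : comNzRingType.

(* Convergence in the q-adic topology: every coefficient is eventually
   constant. *)
Definition fps_cvg_to (s : nat -> fps R) (l : fps R) : Prop :=
  forall n, exists m0, forall m, (m0 <= m)%N -> s m n = l n.

Definition fps_lim (s : nat -> fps R) : fps R :=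
  xget 0 [set l | fps_cvg_to s l]%classic.

(* A family is summable over [A] when each power of q occurs in only finitely
   many members; its sum is then computed coefficientwise. *)
Definition fps_summable (I : choiceType) (A : set I) (F : I -> fps R) : Prop :=
  forall n, finite_set [set i | A i /\ F i n != 0]%classic.

Definition fps_sum (I : choiceType) (A : set I) (F : I -> fps R) : fps R :=
  FPS (fun n => \sum_(i \in A) F i n).

End FpsLimits.

Section QPochhammer.
Variable R : comNzRingType.

Definition fps_q : fps R := FPS (fun n => (n == 1%N)%:R).

(* (a; p)_oo = \prod_(j >= 0) (1 - a p^j) *)
Definition qpochinf (a p : fps R) : fps R :=
  fps_lim (fun m => \prod_(j < m) (1 - a * p ^+ j)).

(* (a_1, ..., a_r; p)_oo *)
Definition qpochinfs (s : seq (fps R)) (p : fps R) : fps R :=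
  \prod_(a <- s) qpochinf a p.

(* a q^n for an integer n; meaningful for n < 0 when q^(-n) divides a, as in
   (-q) q^(-1) = -1. *)
Definition fps_shift (a : fps R) (n : int) : fps R :=
  FPS (fun m => if (m%:Z - n)%R is Posz j then a j else 0).

(* (a)_n = (a; q)_oo / (a q^n; q)_oo for an integer n *)
Definition qpoch (a : fps R) (n : int) : fps R :=
  qpochinf a fps_q / qpochinf (fps_shift a n) fps_q.

End QPochhammer.

Arguments fps_q {R}.

Section Facts.
Variable R : comUnitRingType.
Implicit Types (a p x l : fps R) (s : nat -> fps R).

Let inv_seq x := fix f n : seq R := if n is m.+1 then
  rcons (f m) ((x 0%N)^-1 * ((m == 0%N)%:R - \sum_(j < m) (f m)`_j * x (m - j)%N))
  else [::].

Let size_inv_seq x n : size (inv_seq x n) = n.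
Proof. by elim: n => //= n IHn; rewrite size_rcons IHn. Qed.

Let nth_inv_seq x n j : (j < n)%N -> (inv_seq x n)`_j = (inv_seq x j.+1)`_j.
Proof.
elim: n => // n IHn; rewrite ltnS leq_eqVlt => /predU1P[->//|ltjn].
by rewrite [in LHS]/= nth_rcons size_inv_seq ltjn IHn.
Qed.

Lemma fps_unit_coef0 x : x 0%N \is a GRing.unit -> x \is a GRing.unit.
Proof.
move=> ux; apply/asboolP; exists (FPS (fun n => (inv_seq x n.+1)`_n)).
apply: fpsP => n; rewrite coefM_fps big_ord_recr /= subnn.
rewrite nth_rcons size_inv_seq ltnn eqxx.
rewrite mulrC mulrA divrr // mul1r.
rewrite (eq_bigr (fun j : 'I_n => (inv_seq x n)`_j * x (n - j)%N)).
  by rewrite [LHS]addrC subrK.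
move=> j _; congr (_ * _); exact: esym (nth_inv_seq _ (ltn_ord j)).
Qed.

Lemma fps_cvg_lim s l : fps_cvg_to s l -> fps_lim s = l.
Proof.
move=> sl; apply: fpsP => n.
have [m0 sl_n] := sl n.
have [m1 sL_n] := (xgetPex 0 (ex_intro _ l sl) : fps_cvg_to s (fps_lim s)) n.
by rewrite -(sL_n (maxn m0 m1)) ?leq_maxr // sl_n ?leq_maxl.
Qed.

Lemma fps_cvg_mull x s l :
  fps_cvg_to s l -> fps_cvg_to (fun m => x * s m) (x * l).
Proof.
move=> sl n.
have /choice[f fP] := sl; exists (\max_(i < n.+1) f i) => m lem.
rewrite !coefM_fps; apply: eq_bigr => i _; congr (_ * _); apply: fP.
apply: leq_trans lem; have lti : (n - i < n.+1)%N by rewrite ltnS leq_subr.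
exact: (leq_bigmax (F := fun i : 'I_n.+1 => f i) (Ordinal lti)).
Qed.

Lemma coef_expr_fps p j n : p 0%N = 0 -> (n < j)%N -> (p ^+ j) n = 0.
Proof.
move=> p0; elim: j n => // j IHj n; rewrite ltnS => lenj.
rewrite exprS coefM_fps big1 // => -[[|i] /= lti] _; first by rewrite p0 mul0r.
rewrite IHj ?mulr0 //; apply: leq_trans lenj.
by rewrite ltn_subrL; case: (n) lti.
Qed.

Lemma qpochinf_cvg a p : p 0%N = 0 ->
  fps_cvg_to (fun m => \prod_(j < m) (1 - a * p ^+ j)) (qpochinf a p).
Proof.
move=> p0; set s := fun m => _.
suff sl : fps_cvg_to s (FPS (fun n => s n.+1 n)).
  by rewrite /qpochinf -/s (fps_cvg_lim sl).
move=> n; exists n.+1; elim=> // m IHm; rewrite leq_eqVlt => /predU1P[[<-]//|].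
rewrite ltnS => lenm; rewrite -(IHm lenm).
have -> : s m.+1 = s m - s m * a * p ^+ m.
  by rewrite /s big_ord_recr /= mulrBr mulr1 mulrA.
rewrite coefD_fps coefN_fps coefM_fps big1 ?subr0 // => i _.
by rewrite coef_expr_fps ?mulr0 // (leq_ltn_trans (leq_subr i n) lenm).
Qed.

Lemma qpochinf_split a p n : p 0%N = 0 ->
  qpochinf a p = (\prod_(j < n) (1 - a * p ^+ j)) * qpochinf (a * p ^+ n) p.
Proof.
move=> p0; set x := \prod_(j < n) _; apply: fps_cvg_lim => k.
have [m0 cvk] := fps_cvg_mull x (qpochinf_cvg (a * p ^+ n) p0) k.
exists (n + m0)%N => m lem; have lenm := leq_trans (leq_addr m0 n) lem.
rewrite -(cvk (m - n)%N) ?leq_subRL //; congr (fps_coef _ k).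
rewrite -[in LHS](subnKC lenm) big_split_ord /=; congr (_ * _).
by apply: eq_bigr => j _; rewrite exprD mulrA.
Qed.

Lemma qpochinf_unit a p :
  a 0%N = 0 -> p 0%N = 0 -> qpochinf a p \is a GRing.unit.
Proof.
move=> a0 p0; apply: fps_unit_coef0.
have [m0 cv0] := qpochinf_cvg a p0 0%N; rewrite -(cv0 m0) //.
elim: m0 {cv0} => [|m IHm].
  by rewrite big_ord0 coef1_fps unitr1.
rewrite big_ord_recr coefM_fps big_ord1 unitrM IHm coefD_fps coefN_fps.
by rewrite coefM_fps big_ord1 a0 mul0r subr0 coef1_fps unitr1.
Qed.

Lemma coef_mul_q a n : (a * fps_q) n = if n is m.+1 then a m else 0.
Proof.
rewrite coefM_fps; case: n => [|n]; first by rewrite big_ord1 mulr0.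
rewrite !big_ord_recr /= subnn subSnn mulr1 mulr0 addr0 big1 ?add0r // => i _.
by rewrite subSn ?(ltnW (ltn_ord i)) //= eqSS subn_eq0 leqNgt ltn_ord mulr0.
Qed.

Lemma coef_fps_shift a (n : int) m :
  fps_shift a n m = if m%:Z - n is Posz j then a j else 0.
Proof. by []. Qed.

Lemma fps_shift_nat a (n : nat) : fps_shift a n = a * fps_q ^+ n.
Proof.
elim: n => [|n IHn].
  by rewrite mulr1; apply: fpsP => m; rewrite coef_fps_shift subr0.
apply: fpsP => m; rewrite exprSr mulrA -IHn coef_mul_q coef_fps_shift.
case: m => [|m]; first by rewrite sub0r.
by rewrite coef_fps_shift subzSS.
Qed.

Lemma fps_shift_mulq a : fps_shift (a * fps_q) (-1) = a.
Proof.
apply: fpsP => m; rewrite coef_fps_shift opprK -PoszD addn1.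
exact: (coef_mul_q a m.+1).
Qed.

Lemma qpoch_nat a (n : nat) : a 0%N = 0 ->
  qpoch a n = \prod_(j < n) (1 - a * fps_q ^+ j).
Proof.
move=> a0; rewrite /qpoch fps_shift_nat (@qpochinf_split a _ n) // mulrK //.
by apply: qpochinf_unit; rewrite // coefM_fps big_ord1 a0 mul0r.
Qed.

Lemma qpoch_Nq_N1 : 2%:R \is a @GRing.unit R ->
  qpoch (- fps_q : fps R) (-1) = 2%:R^-1.
Proof.
move=> u2; rewrite /qpoch -[in X in _ / X](mulN1r fps_q) fps_shift_mulq.
rewrite (@qpochinf_split (-1) _ 1) // big_ord1 expr0 mulr1 opprK expr1 mulN1r.
have uq : qpochinf (- fps_q) fps_q \is a @GRing.unit (fps R).
  by apply: qpochinf_unit; rewrite // coefN_fps oppr0.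
have u2' : (1 + 1 : fps R) \is a GRing.unit by apply: fps_unit_coef0.
by rewrite invrM // mulrA divrr // mul1r.
Qed.

End Facts.

(* For N = (N_1, ..., N_(k-1)), [part N r] is N_r if 1 <= r < k, and 0 if
   r >= k; in particular N_k = 0. *)
Definition part (k : nat) (N : k.-1.-tuple nat) (r : nat) : nat :=
  nth 0%N N r.-1.

(* N_1 >= N_2 >= ... >= N_(k-1) *)
Definition chains (k : nat) : set (k.-1.-tuple nat) :=
  [set N : k.-1.-tuple nat | sorted geq N]%classic.

Definition exponent (k i : nat) (N : k.-1.-tuple nat) : nat :=
  (((part N 1 + 1) * part N 1) %/ 2 + \sum_(2 <= r < k) part N r ^ 2
   + \sum_(i.+1 <= r < k) part N r)%N.

(* Coefficients are rational because (-q)_(-1) = 1/2. *)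
Definition summand (k i : nat) (N : k.-1.-tuple nat) : fps rat :=
  fps_q ^+ exponent i N * qpoch (- fps_q) ((part N 1)%:Z - 1)
    * (1 + fps_q ^+ part N i)
  / ((\prod_(1 <= r < k.-1)
        qpoch fps_q ((part N r)%:Z - (part N r.+1)%:Z))
     * qpoch fps_q (part N k.-1)%:Z).

Arguments chains : clear implicits.
Arguments summand : clear implicits.

(* Main.v *)
(** Bailey chain argument.  Write x_s(n) = 1 / ((q)_(n-s) (q)_(n+s)).  The
    q-Chu-Vandermonde sum shows that f |-> sum_(m <= n) q^(m^2) / (q)_(n-m) f(m)
    multiplies x_s by q^(s^2).  The delta function at 0 is a combination
    sum_(r >= 0) c_r (x_r - q^(2r+1) x_(r+1)), and multiplication by q^n turns
    such a combination into sum_(r >= 0) c_r q^r (x_r - x_(r+1)), because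
    x_r (1 - q^(n-r)) = x_(r+1) (1 - q^(n+r+1)).  So all the inner sums, over
    N_(k-1), ..., N_2, and the factor 1 + q^(N_i) act on the coefficients alone.
    The sum over N_1, weighted by (-q)_(N_1-1) q^(N_1(N_1+1)/2), is again of
    q-Chu-Vandermonde type and brings out the theta series
    sum_r (-1)^r q^(k r^2 + (k-i) r), which is a product by the Jacobi triple
    product identity.  Everything is proved at finite level, with an extra factor
    1 / (q)_(N-N_1), and N is sent to infinity modulo each power of q. *)
Require Import Defs.
From mathcomp Require Import all_boot all_order all_algebra.
From mathcomp Require Import boolp classical_sets cardinality fsbigop.
From mathcomp Require Import ring zify.
Set Implicit Arguments.
Unset Strict Implicit.
Unset Printing Implicit Defensive.

Import Order.TTheory GRing.Theory Num.Theory.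
Local Open Scope ring_scope.

(** * Gaussian binomials *)

Section QBinomial.
Variable R : comNzRingType.
Implicit Types (a c u q A : R) (m n s t N : nat).

Definition qprod a q n : R := \prod_(j < n) (1 - a * q ^+ j).

(** Defined by the q-Pascal rule and not as a quotient, so that no factor 1 - q^j has to be
    invertible. *)
Fixpoint qbin q N t : R :=
  match N, t with
  | _, 0 => 1
  | 0, _.+1 => 0
  | N'.+1, t'.+1 => q ^+ t'.+1 * qbin q N' t'.+1 + qbin q N' t'
  end.

Lemma qprodS a q n : qprod a q n.+1 = qprod a q n * (1 - a * q ^+ n).
Proof. by rewrite /qprod big_ord_recr. Qed.

Lemma qprodD a q m n : qprod a q (m + n) = qprod a q m * qprod (a * q ^+ m) q n.
Proof.
rewrite /qprod big_split_ord /=; congr (_ * _).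
by apply: eq_bigr => j _; rewrite exprD mulrA.
Qed.

Lemma qbin0 q N : qbin q N 0 = 1. Proof. by case: N. Qed.

Lemma qbinS q N t :
  qbin q N.+1 t.+1 = q ^+ t.+1 * qbin q N t.+1 + qbin q N t.
Proof. by []. Qed.

Lemma qbin_small q N t : (N < t)%N -> qbin q N t = 0.
Proof.
elim: N t => [|N IHN] [|t] //= ltNt.
by rewrite !IHN ?mulr0 ?addr0 // ltnW.
Qed.

Lemma qbin_prod q t s :
  qbin q (t + s) t * qprod q q t * qprod q q s = qprod q q (t + s).
Proof.
have [N] := ubnP (t + s); elim: N t s => // N IHN [|t] [|s] ltN.
- by rewrite /qprod !big_ord0 /= !mul1r.
- by rewrite qbin0 /qprod big_ord0 !mul1r.
- have -> : qbin q (t.+1 + 0) t.+1 = qbin q (t + 0) t.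
    by rewrite addSn /= qbin_small ?addn0 // mulr0 add0r.
  rewrite addSn !qprodS -(IHN t 0) //= addn0; ring.
rewrite addnS ltnS in ltN; rewrite addnS qbinS.
have e1 := IHN t s.+1; have e2 := IHN t.+1 s.
rewrite addnS qprodS in e1; rewrite addSn qprodS in e2; rewrite addSn.
rewrite !qprodS in e1 e2 *.
(* The weights of the two Pascal terms add up to the missing factor: q^(t+1) (1 - q^(s+1)) + (1 -
   q^(t+1)) = 1 - q^(t+s+2). *)
transitivity (
    q ^+ t.+1 * (1 - q * q ^+ s) * (qprod q q (t + s) * (1 - q * q ^+ (t + s)))
  + (1 - q * q ^+ t) * (qprod q q (t + s) * (1 - q * q ^+ (t + s)))).
  by rewrite -{1}e2 ?addSn // -e1 //; ring.
by rewrite !exprS exprD; ring.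
Qed.

Lemma bin2D m n : 'C(m + n, 2) = ('C(m, 2) + 'C(n, 2) + m * n)%N.
Proof.
elim: n => [|n IHn]; first by rewrite addn0 muln0 !addn0.
by rewrite addnS !binS !bin1 IHn; lia.
Qed.

Lemma sqrn_bin2 m : (m ^ 2 = m + 2 * 'C(m, 2))%N.
Proof. by elim: m => // m IHm; rewrite binS bin1; lia. Qed.

Lemma prod_expr_ord q m : \prod_(j < m) q ^+ j = q ^+ 'C(m, 2).
Proof.
elim: m => [|m IHm]; first by rewrite big_ord0.
by rewrite big_ord_recr /= IHm -exprD binS bin1.
Qed.

(* The q-Chu-Vandermonde sum, cleared of denominators and homogenized by [A]
   so that it also contains the q-binomial theorem ([c = 0]). *)
Lemma qChu_Vandermonde A c u q N :
  \sum_(t < N.+1) qbin q N t * q ^+ 'C(t, 2) * \prod_(j < t) (c * q ^+ j - u)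
     * \prod_(t <= j < N) (A - c * q ^+ j)
  = \prod_(j < N) (A - u * q ^+ j).
Proof.
elim: N c u => [|N IHN] c u.
  by rewrite big_ord1 big_nat big_pred0 ?big_ord0 ?mulr1 //.
(* Once A - u is split off, the other factors form the product for u q, so the induction hypothesis
   is used at c q and u q. *)
rewrite [RHS]big_ord_recl expr0 mulr1.
have -> : \prod_(j < N) (A - u * q ^+ bump 0 j)
          = \prod_(j < N) (A - (u * q) * q ^+ j).
  by apply: eq_bigr => j _; rewrite exprS mulrA.
rewrite -(IHN (c * q)) mulr_sumr.
set P := fun t => \prod_(j < t) (c * q ^+ j - u).
set D := fun t N => \prod_(t <= j < N) (A - c * q ^+ j).
(* After Pascal's rule and an index shift in the second half, the terms pair up through (A - c q^t)
   + (c q^t - u) = A - u. *)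
rewrite (eq_bigr (fun t : 'I_N.+2 =>
    q ^+ t * qbin q N t * q ^+ 'C(t, 2) * P t * D t N.+1
    + (if (t : nat) is t'.+1 then qbin q N t' * q ^+ 'C(t, 2) * P t * D t N.+1
       else 0))); last first.
  move=> [[|t] lt] _; first by rewrite expr0 !mul1r addr0 !qbin0 !mul1r.
  by rewrite qbinS !mulrDl.
rewrite big_split big_ord_recr /= qbin_small // mulr0 !mul0r addr0.
rewrite [X in _ + X = _]big_ord_recl /= add0r -big_split.
apply: eq_bigr => -[t /= ltN] _.
have -> : \prod_(j < t) (c * q * q ^+ j - u * q) = q ^+ t * P t.
  rewrite -[t in q ^+ t]card_ord -prodr_const -big_split.
  by apply: eq_bigr => j _ /=; ring.
have -> : \prod_(t <= j < N) (A - c * q * q ^+ j) = D t.+1 N.+1.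
  by rewrite /D big_add1; apply: eq_bigr => j _; rewrite exprS mulrA.
have -> : D t N.+1 = (A - c * q ^+ t) * D t.+1 N.+1 by rewrite /D big_ltn.
have -> : P t.+1 = P t * (c * q ^+ t - u) by rewrite /P big_ord_recr.
rewrite /bump /= add1n binS bin1 exprD; ring.
Qed.

End QBinomial.

(** * Bailey chain *)

Section BaileyKernel.
Variables (R : comUnitRingType) (q : R).
Hypothesis unit1Bq : forall n, 1 - q ^+ n.+1 \is a GRing.unit.
Implicit Types (u : R) (m n r s t N L : nat) (f g : nat -> R).

Local Notation qfact := (qprod q q).

Lemma qfact_unit n : qfact n \is a GRing.unit.
Proof. by apply: rpred_prod => j _; rewrite -exprS. Qed.

Lemma qbinE m t : (t <= m)%N -> qbin q m t = qfact m / (qfact t * qfact (m - t)).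
Proof.
move=> letm; have := qbin_prod q t (m - t); rewrite subnKC // => <-.
by rewrite -(mulrA (qbin _ _ _)) mulrK // unitrM !qfact_unit.
Qed.

Lemma qfact_tail d t m : (t <= m)%N ->
  \prod_(t <= j < m) (1 - q ^+ d.+1 * q ^+ j) = qfact (d + m) / qfact (d + t).
Proof.
move=> letm; apply: (mulIr (qfact_unit (d + t))); rewrite divrK ?qfact_unit //.
rewrite -(subnKC letm) addnA [RHS]qprodD [LHS]mulrC; congr (_ * _).
rewrite /qprod -[X in \prod_(X <= _ < _) _]add0n big_addn addKn big_mkord.
by apply: eq_bigr => j _; rewrite exprS !exprD; congr (1 - _); ring.
Qed.

(* [bailey_ker s n] is 1 / ((q)_(n-s) (q)_(n+s)), which vanishes for n < s. *)
Definition bailey_ker s n : R :=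
  if (s <= n)%N then (qfact (n - s) * qfact (n + s))^-1 else 0.

Lemma bailey_ker_small s n : (n < s)%N -> bailey_ker s n = 0.
Proof. by rewrite /bailey_ker ltnNge => /negbTE ->. Qed.

(** With n = s + t this is the q-Chu-Vandermonde sum for A = 1 and c = q^(2s+1). The free [u]
    becomes 0 in the Bailey step and - q^(s+1) in the sum over N_1. *)
Lemma bailey_ker_sum u s N :
  \sum_(n < N.+1) q ^+ 'C(n - s, 2)
      * \prod_(j < n - s) (q ^+ (2 * s).+1 * q ^+ j - u) / qfact (N - n)
      * bailey_ker s n
  = qprod u q (N - s) * bailey_ker s N.
Proof.
have [ltNs|lesN] := ltnP N s.
  rewrite bailey_ker_small // mulr0 big1 // => n _.
  by rewrite bailey_ker_small ?mulr0 // (leq_trans (ltn_ord n)).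
rewrite -(subnKC lesN); set m := (N - s)%N.
rewrite -addnS big_split_ord /= big1 ?add0r => [|n _]; last first.
  by rewrite bailey_ker_small ?mulr0.
rewrite addKn [qprod u q m]/qprod -(qChu_Vandermonde 1 (q ^+ (2 * s).+1)) mulr_suml.
apply: eq_bigr => -[t /= letm] _; rewrite ltnS in letm.
rewrite addKn subnDl /bailey_ker !leq_addr !addKn qbinE // qfact_tail //.
have -> : (s + t + s = 2 * s + t)%N by lia.
have -> : (s + m + s = 2 * s + m)%N by lia.
have [[um ut] umt] := (qfact_unit m, qfact_unit t, qfact_unit (m - t)).
have [u2m u2t] := (qfact_unit (2 * s + m), qfact_unit (2 * s + t)).
rewrite !invrM ?unitrM ?um ?ut ?umt ?u2m ?u2t //.
by rewrite -[LHS](mulrK um) -[LHS](mulrK u2m); ring.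
Qed.

Lemma bailey_ker_step s N :
  \sum_(n < N.+1) q ^+ (n ^ 2) / qfact (N - n) * bailey_ker s n
  = q ^+ (s ^ 2) * bailey_ker s N.
Proof.
transitivity (q ^+ (s ^ 2) * (qprod 0 q (N - s) * bailey_ker s N)); last first.
  by rewrite /qprod big1 ?mul1r // => j _; rewrite mul0r subr0.
rewrite -bailey_ker_sum mulr_sumr; apply: eq_bigr => -[n /= _] _.
have [ltns|lesn] := ltnP n s; first by rewrite bailey_ker_small ?mulr0.
rewrite !mulrA; congr (_ / _ * _); rewrite -mulrA.
rewrite (eq_bigr (fun j : 'I_(n - s) => q ^+ (2 * s).+1 * q ^+ j)); last first.
  by move=> j _; rewrite subr0.
rewrite big_split /= prodr_const card_ord -exprM prod_expr_ord -!exprD.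
(* With m = n - s, the exponents satisfy s^2 + 2 'C(m, 2) + (2s+1) m = (s + m)^2. *)
congr (_ ^+ _); have := sqrn_bin2 (n - s).
by rewrite -[in LHS](subnKC lesn); set m := (n - s)%N; nia.
Qed.

(** The relation x_r (1 - q^(n-r)) = x_(r+1) (1 - q^(n+r+1)) times q^r, which avoids negative
    exponents; for n <= r both sides vanish. *)
Lemma bailey_ker_rec r n :
  bailey_ker r n * (q ^+ r - q ^+ n)
  = bailey_ker r.+1 n * (q ^+ r - q ^+ (n + 2 * r).+1).
Proof.
have [ltnr|ltrn|->] := ltngtP n r.
- by rewrite !bailey_ker_small ?mul0r // ltnW.
- rewrite /bailey_ker ltrn (ltnW ltrn); set m := (n - r.+1)%N.
  have -> : (n - r = m.+1)%N by rewrite /m; lia.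
  have -> : n = (r + m.+1)%N by rewrite /m; lia.
  have -> : (r + m.+1 + r.+1 = (r + m.+1 + r).+1)%N by lia.
  have -> : ((r + m.+1 + 2 * r).+1 = r + (r + m.+1 + r).+1)%N by lia.
  rewrite !qprodS -!exprS.
  have [um u1] := (qfact_unit m, unit1Bq m).
  have [um' u1'] := (qfact_unit (r + m.+1 + r), unit1Bq (r + m.+1 + r)).
  rewrite !invrM ?unitrM ?um ?um' ?u1 ?u1' //.
  rewrite ![q ^+ (r + _)]exprD -[X in X - _ * _]mulr1 -mulrBr.
  rewrite -[X in _ = _ * (X - _ * _)]mulr1 -mulrBr.
  transitivity ((qfact (r + m.+1 + r))^-1 * (qfact m)^-1 * q ^+ r).
    by rewrite -[RHS](mulrK u1); ring.
  by rewrite -[LHS](mulrK u1'); ring.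
by rewrite subrr mulr0 bailey_ker_small ?mul0r.
Qed.

(* In the application h n = (-q)_(n-1), with h 0 = 1/2. *)
Lemma bailey_ker_final (h : nat -> R) s N :
  h 0%N * 2 = 1 -> (forall n, h n.+1 = qprod (- q) q n) ->
  (1 + q ^+ s) * (\sum_(n < N.+1)
      q ^+ 'C(n.+1, 2) * h n / qfact (N - n) * bailey_ker s n)
  = qprod (- q) q N * q ^+ 'C(s.+1, 2) * bailey_ker s N.
Proof.
move=> h0 hS; have [ltNs|lesN] := ltnP N s.
  rewrite bailey_ker_small // mulr0 big1 ?mulr0 // => n _.
  by rewrite bailey_ker_small ?mulr0 // (leq_trans (ltn_ord n)).
(* [bailey_ker_sum] is applied at u = - q^(s+1); the factor (-q)_s completes (-q^(s+1))_(N-s) to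
   (-q)_N. *)
transitivity (qprod (- q) q s * q ^+ 'C(s.+1, 2)
    * (qprod (- q * q ^+ s) q (N - s) * bailey_ker s N)); last first.
  have -> : qprod (- q) q N = qprod (- q) q s * qprod (- q * q ^+ s) q (N - s).
    by rewrite -qprodD subnKC.
  ring.
rewrite -bailey_ker_sum !mulr_sumr; apply: eq_bigr => -[n /= _] _.
have [ltns|lesn] := ltnP n s; first by rewrite bailey_ker_small ?mulr0.
rewrite !mulrA; congr (_ / _ * _).
have -> : (1 + q ^+ s) * q ^+ 'C(n.+1, 2) * h n =
          q ^+ 'C(n.+1, 2) * (h n * (1 + q ^+ s)) by ring.
(* For n > s the factor 1 + q^s starts a second product overlapping (-q)_s at j = s. The value h 0 =
   1/2 enters at n = s = 0. *)
have -> : h n * (1 + q ^+ s)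
          = qprod (- q) q s * \prod_(j < n - s) (1 + q ^+ s * q ^+ j).
  case: (n - s)%N (subnKC lesn) => [|t] <-.
    rewrite addn0 big_ord0 mulr1; case: (s) => [|m].
      by rewrite expr0 -[1 + 1]/(2 : R) h0 /qprod big_ord0.
    by rewrite hS qprodS exprS mulNr opprK.
  rewrite addnS hS qprodD big_ord_recl expr0 mulr1.
  rewrite -mulrA [qprod _ _ t * _]mulrC; congr (_ * (_ * _)).
  by apply: eq_bigr => j _; rewrite !mulNr opprK lift0 exprS mulrCA mulrA.
rewrite [X in _ = _ * X](eq_bigr (fun j : 'I_(n - s) =>
    q ^+ s.+1 * (1 + q ^+ s * q ^+ j))); last first.
  move=> j _; rewrite mulNr opprK -exprS mulrDr mulr1 addrC mulrA -!exprD.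
  by congr (_ + q ^+ _); lia.
rewrite big_split /= prodr_const card_ord -exprM.
have -> : 'C(n.+1, 2) = ('C(s.+1, 2) + 'C(n - s, 2) + s.+1 * (n - s))%N.
  by rewrite -bin2D addSn subnKC.
rewrite !exprD; ring.
Qed.

(** * Expansions in the kernels under Bailey steps *)

Definition bailey_step f n : R :=
  \sum_(m < n.+1) q ^+ (m ^ 2) / qfact (n - m) * f m.

(** As 1 / ((q)_(n-s) (q)_(n+s)) is even in s, [b r] acts as the coefficient at index - r - 1 of a
    bilateral sum. The cut at [L] loses nothing, since kernels of index r > n vanish at n. *)
Definition ker_expansion L f (a b : nat -> R) :=
  forall n, (n < L)%N ->
  f n = \sum_(r < L) (a r * bailey_ker r n + b r * bailey_ker r.+1 n).

Lemma ker_expansion_step L f a b : ker_expansion L f a b ->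
  ker_expansion L (bailey_step f)
    (fun r => a r * q ^+ (r ^ 2)) (fun r => b r * q ^+ (r.+1 ^ 2)).
Proof.
move=> Ef n ltnL; rewrite /bailey_step.
transitivity (\sum_(m < n.+1) \sum_(r < L)
    (a r * (q ^+ (m ^ 2) / qfact (n - m) * bailey_ker r m)
     + b r * (q ^+ (m ^ 2) / qfact (n - m) * bailey_ker r.+1 m))).
  apply: eq_bigr => m _; rewrite Ef ?(leq_trans (ltn_ord m)) // mulr_sumr.
  by apply: eq_bigr => r _; ring.
rewrite exchange_big; apply: eq_bigr => r _ /=.
by rewrite big_split -!mulr_sumr !bailey_ker_step !mulrA.
Qed.

Lemma ker_expansion_iter L f a b m : ker_expansion L f a b ->
  ker_expansion L (iter m bailey_step f)
    (fun r => a r * q ^+ (m * r ^ 2)) (fun r => b r * q ^+ (m * r.+1 ^ 2)).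
Proof.
move=> Ef; elim: m => [|m IHm].
  by move=> n ltnL; rewrite [LHS]Ef //; apply: eq_bigr => r _; rewrite !mulr1.
move=> n ltnL; rewrite [LHS](ker_expansion_step IHm) //; apply: eq_bigr => r _ /=.
by rewrite -(mulrA (a r)) -(mulrA (b r)) -!exprD -!mulSnr.
Qed.

(* The bilateral sequence underlying [c] is odd under r -> - r - 1, which lets
   multiplication by q^n act on its coefficients. *)
Lemma ker_expansion_mulX L f c :
  ker_expansion L f c (fun r => - c r * q ^+ (2 * r).+1) ->
  ker_expansion L (fun n => q ^+ n * f n)
    (fun r => c r * q ^+ r) (fun r => - c r * q ^+ r).
Proof.
move=> Ef n ltnL; rewrite Ef // mulr_sumr; apply: eq_bigr => r _.
have := bailey_ker_rec r n; rewrite -addnS exprD => e.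
apply/eqP; rewrite -subr_eq0; apply/eqP.
transitivity (c r * (bailey_ker r.+1 n * (q ^+ r - q ^+ n * q ^+ (2 * r).+1)
  - bailey_ker r n * (q ^+ r - q ^+ n))); first by ring.
by rewrite e subrr mulr0.
Qed.

Lemma ker_expansion_delta L :
  ker_expansion L (fun n => (n == 0%N)%:R)
    (fun r => (-1) ^+ r * q ^+ 'C(r, 2))
    (fun r => - ((-1) ^+ r * q ^+ 'C(r, 2)) * q ^+ (2 * r).+1).
Proof.
case=> [|n] ltnL.
  case: L ltnL => // L _; rewrite big_ord_recl big1 ?addr0 => [|r _].
    rewrite (bailey_ker_small (ltn0Sn 0)) /bailey_ker /= /qprod !big_ord0.
    by rewrite !expr0 !mul1r mulr0 addr0 invr1.
  by rewrite !bailey_ker_small // !mulr0 addr0.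
apply: (mulrI (unit1Bq n)); rewrite mulr0 mulr_sumr.
(* Chosen so that 1 - q^(n+1) times the r-th term is U r - U (r+1). U 0 vanishes by its factor 1 -
   q^0, and U L because L > n + 1. *)
pose U r := (-1) ^+ r * q ^+ 'C(r, 2) * (1 - q ^+ r) * bailey_ker r n.+1.
transitivity (- \sum_(0 <= r < L) (U r.+1 - U r)).
  by rewrite telescope_sumr // /U bailey_ker_small // subrr !mulr0 mul0r subrr oppr0.
rewrite big_mkord -sumrN; apply: eq_bigr => r _.
have := bailey_ker_rec r n.+1; rewrite -addnS exprD => e.
apply/eqP; rewrite -subr_eq0; apply/eqP.
transitivity ((-1) ^+ r * q ^+ 'C(r, 2) *
    (bailey_ker r.+1 n.+1 * (q ^+ r - q ^+ n.+1 * q ^+ (2 * r).+1)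
     - bailey_ker r n.+1 * (q ^+ r - q ^+ n.+1))).
  rewrite /U binS bin1 exprD exprS !exprS mul2n -addnn exprD; ring.
by rewrite e subrr mulr0.
Qed.

(** Multiplication by q^n followed by a step scales [c r] by q^(r^2+r); the second coefficient gains
    q^r q^((r+1)^2) / q^(2r+1), the same power. The shape required by [ker_expansion_mulX] thus
    persists. *)
Lemma ker_expansion_delta_iter L j :
  let c r := (-1) ^+ r * q ^+ ('C(r, 2) + j * (r ^ 2 + r)) in
  ker_expansion L
    (iter j (fun f => bailey_step (fun n => q ^+ n * f n))
       (fun n => (n == 0%N)%:R))
    c (fun r => - c r * q ^+ (2 * r).+1).
Proof.
elim: j => [|j IHj] c n ltnL.
  rewrite [LHS](ker_expansion_delta ltnL); apply: eq_bigr => r _.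
  by rewrite /c addn0.
rewrite [LHS](ker_expansion_step (ker_expansion_mulX IHj)) //.
apply: eq_bigr => r _ /=; rewrite /c; congr (_ * _ + _ * _).
  by rewrite -!mulrA -!exprD; congr (_ * q ^+ _); lia.
by rewrite !mulNr -!mulrA -!exprD; congr (- (_ * q ^+ _)); lia.
Qed.

(** At i - 1 and k - i this is the sum over N_2, ..., N_k as a function of N_1: the delta function
    imposes N_k = 0, the first k - i steps carry the weights q^(N_r) with r > i, and then comes 1 +
    q^(N_i). *)
Definition bailey_iter i j : nat -> R :=
  iter i bailey_step (fun n => (1 + q ^+ n) *
    iter j (fun f => bailey_step (fun n => q ^+ n * f n))
      (fun n => (n == 0%N)%:R) n).

(** Adding the expansions of f and q^n f produces the factors 1 + q^r on x_r and 1 + q^(r+1) on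
    x_(r+1), exactly those that [bailey_ker_final] absorbs. *)
Lemma ker_expansion_bailey_iter L i j :
  let c r := (-1) ^+ r * q ^+ ('C(r, 2) + j * (r ^ 2 + r)) in
  ker_expansion L (bailey_iter i j)
    (fun r => c r * q ^+ (i * r ^ 2) * (1 + q ^+ r))
    (fun r => - c r * q ^+ (i * r.+1 ^ 2 + r) * (1 + q ^+ r.+1)).
Proof.
move=> c; rewrite /bailey_iter; set f := iter j _ _.
have Ef : ker_expansion L f c (fun r => - c r * q ^+ (2 * r).+1).
  exact: ker_expansion_delta_iter.
have E1f : ker_expansion L (fun n => (1 + q ^+ n) * f n)
    (fun r => c r * (1 + q ^+ r)) (fun r => - c r * q ^+ r * (1 + q ^+ r.+1)).
  move=> n ltnL; rewrite mulrDl mul1r (ker_expansion_mulX Ef) // Ef //.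
  rewrite -big_split; apply: eq_bigr => r _ /=.
  by rewrite !exprS mul2n -addnn exprD; ring.
move=> n ltnL; rewrite (ker_expansion_iter i E1f) //.
by apply: eq_bigr => r _; rewrite exprD; ring.
Qed.

Lemma bailey_iter_final (h : nat -> R) N k i :
  (0 < i <= k)%N -> h 0%N * 2 = 1 -> (forall n, h n.+1 = qprod (- q) q n) ->
  \sum_(n < N.+1)
      q ^+ 'C(n.+1, 2) * h n / qfact (N - n) * bailey_iter i.-1 (k - i) n
  = qprod (- q) q N * \sum_(r < N.+1) (-1) ^+ r *
     (q ^+ (k * r ^ 2 + (k - i) * r) * bailey_ker r N
      - q ^+ (k * r.+1 ^ 2 - (k - i) * r.+1) * bailey_ker r.+1 N).
Proof.
case: i => [//|i] /= ltik h0 hS.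
pose c r := (-1) ^+ r * q ^+ ('C(r, 2) + (k - i.+1) * (r ^ 2 + r)).
pose w n := q ^+ 'C(n.+1, 2) * h n / qfact (N - n).
transitivity (\sum_(n < N.+1) \sum_(r < N.+1)
   (c r * q ^+ (i * r ^ 2) * ((1 + q ^+ r) * (w n * bailey_ker r n))
  - c r * q ^+ (i * r.+1 ^ 2 + r) *
       ((1 + q ^+ r.+1) * (w n * bailey_ker r.+1 n)))).
  apply: eq_bigr => n _.
  rewrite (ker_expansion_bailey_iter i (k - i.+1) (ltn_ord n)).
  by rewrite mulr_sumr; apply: eq_bigr => r _; rewrite /w /c; ring.
rewrite exchange_big mulr_sumr; apply: eq_bigr => r _ /=.
rewrite sumrB -!mulr_sumr /w !bailey_ker_final // /c.
have -> : (k * r ^ 2 + (k - i.+1) * r =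
           'C(r, 2) + (k - i.+1) * (r ^ 2 + r) + i * r ^ 2 + 'C(r.+1, 2))%N.
  have := sqrn_bin2 r; rewrite binS bin1 -{1}(subnKC ltik).
  by set j := (k - i.+1)%N; nia.
have -> : (k * r.+1 ^ 2 - (k - i.+1) * r.+1 =
           'C(r, 2) + (k - i.+1) * (r ^ 2 + r) + (i * r.+1 ^ 2 + r)
           + 'C(r.+2, 2))%N.
  apply: (canLR (addnK _)) => /=.
  have := sqrn_bin2 r; rewrite !binS !bin1 bin0 -{1}(subnKC ltik).
  by set j := (k - i.+1)%N; nia.
rewrite !(exprD q ('C(r, 2) + _ + _)) !(exprD q ('C(r, 2) + _)); ring.
Qed.

(** * Finite form of the Jacobi triple product *)

Lemma qbin_center_add n r : (r <= n)%N ->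
  qbin q (n + n) (n + r) = qfact (n + n) * bailey_ker r n.
Proof.
move=> lern; rewrite qbinE ?leq_add2l // subnDl mulrC.
by rewrite /bailey_ker lern [_ * qfact (n - r)]mulrC mulrC.
Qed.

Lemma qbin_center_sub n r : (r <= n)%N ->
  qbin q (n + n) (n - r) = qfact (n + n) * bailey_ker r n.
Proof.
move=> lern; rewrite qbinE; last by rewrite (leq_trans (leq_subr r n)) ?leq_addr.
by rewrite /bailey_ker lern; congr (_ / (_ * qfact _)); lia.
Qed.

(* The q-binomial theorem for the product of the 1 - z q^(j-n), j < 2n; these
   are multiplied by q^n and then the surplus power of q, a regular element, is
   cancelled. *)
Lemma jacobi_triple_finite z w n :
  GRing.lreg q -> GRing.lreg z -> z * w = q ->
  qprod z q n * qprod w q n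
  = qfact (n + n) * \sum_(r < n.+1) (-1) ^+ r *
      (z ^+ r * q ^+ 'C(r, 2) * bailey_ker r n
       - w ^+ r.+1 * q ^+ 'C(r.+1, 2) * bailey_ker r.+1 n).
Proof.
move=> regq regz zw.
have reg : GRing.lreg ((- z) ^+ n * q ^+ ('C(n, 2) + n * n)).
  by apply: lregM; apply: lregX => //; apply: lregN.
apply: reg; set K := (- z) ^+ n * _.
(* The factors with j < n, in reverse order, give (w)_n through z w = q; those with j >= n give
   (z)_n. *)
transitivity (\prod_(j < n + n) (q ^+ n - z * q ^+ j)).
  rewrite big_split_ord /=.
  have -> : \prod_(j < n) (q ^+ n - z * q ^+ j)
            = (- z) ^+ n * q ^+ 'C(n, 2) * qprod w q n.
    have -> : (- z) ^+ n = \prod_(j < n) (- z) by rewrite prodr_const card_ord.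
    have -> : q ^+ 'C(n, 2) = \prod_(j < n) q ^+ (n - j.+1).
      by rewrite -prod_expr_ord (reindex_inj rev_ord_inj).
    rewrite (reindex_inj rev_ord_inj) -!big_split; apply: eq_bigr => j _ /=.
    have -> : q ^+ n = q ^+ (n - j.+1) * (z * w * q ^+ j).
      by rewrite zw -exprS -exprD subnK.
    ring.
  have -> : \prod_(j < n) (q ^+ n - z * q ^+ (n + j)) = q ^+ (n * n) * qprod z q n.
    have -> : q ^+ (n * n) = \prod_(j < n) q ^+ n.
      by rewrite prodr_const card_ord exprM.
    rewrite -big_split.
    by apply: eq_bigr => j _ /=; rewrite exprD; ring.
  rewrite /K exprD; ring.
have prod0z m : \prod_(j < m) (0 * q ^+ j - z) = (- z) ^+ m.
  rewrite -[m in RHS]card_ord -prodr_const.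
  by apply: eq_bigr => j _; rewrite mul0r sub0r.
have prod0q m : \prod_(m <= j < n + n) (q ^+ n - 0 * q ^+ j)
                = q ^+ (n * (n + n - m)).
  rewrite exprM -prodr_const_nat.
  by apply: eq_bigr => j _; rewrite mul0r subr0.
(* With c = 0, the terms t = n + r match the powers of z and the terms t = n - r - 1 those of w. *)
rewrite -(qChu_Vandermonde _ 0) -addnS big_split_ord /= addrC.
rewrite [X in _ = K * (_ * X)](_ : _ =
    \sum_(r < n.+1) (-1) ^+ r * (z ^+ r * q ^+ 'C(r, 2) * bailey_ker r n)
  - \sum_(r < n.+1) (-1) ^+ r *
      (w ^+ r.+1 * q ^+ 'C(r.+1, 2) * bailey_ker r.+1 n)); last first.
  by rewrite -sumrB; apply: eq_bigr => r _; rewrite mulrBr.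
rewrite !mulrBr; congr (_ + _).
  rewrite !mulr_sumr; apply: eq_bigr => -[r /= ltrn] _.
  rewrite qbin_center_add //.
  rewrite prod0z prod0q /K.
  have -> : (-1) ^+ r * (z ^+ r * q ^+ 'C(r, 2) * bailey_ker r n)
            = (- z) ^+ r * q ^+ 'C(r, 2) * bailey_ker r n.
    by rewrite [(- z) ^+ _]exprNn; ring.
  transitivity (qfact (n + n) * bailey_ker r n * (- z) ^+ (n + r)
      * q ^+ ('C(n + r, 2) + n * (n + n - (n + r)))).
    by rewrite (exprD _ 'C(_, 2)); ring.
  have -> : ('C(n + r, 2) + n * (n + n - (n + r)) =
             'C(n, 2) + n * n + 'C(r, 2))%N.
    by rewrite bin2D; have := subnKC ltrn; set m := (n - r)%N; nia.
  rewrite !exprD; ring.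
rewrite big_ord_recr /= bailey_ker_small // !mulr0 addr0.
rewrite (reindex_inj rev_ord_inj) -mulrN -mulrN -sumrN !mulr_sumr /=.
apply: eq_bigr => -[r /= ltrn] _.
rewrite qbin_center_sub //.
rewrite prod0z prod0q /K.
have -> : (-1) ^+ r * (w ^+ r.+1 * q ^+ 'C(r.+1, 2) * bailey_ker r.+1 n)
          = - ((- w) ^+ r.+1 * q ^+ 'C(r.+1, 2) * bailey_ker r.+1 n).
  by rewrite [(- w) ^+ _]exprNn (exprS (-1)); ring.
have -> : (- z) ^+ n = (- z) ^+ (n - r.+1) * (- z) ^+ r.+1.
  by rewrite -exprD subnK.
transitivity (qfact (n + n) * bailey_ker r.+1 n * (- z) ^+ (n - r.+1)
    * q ^+ ('C(n - r.+1, 2) + n * (n + n - (n - r.+1)))).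
  by rewrite exprD; ring.
have -> : ('C(n - r.+1, 2) + n * (n + n - (n - r.+1)) =
           'C(n, 2) + n * n + 'C(r.+1, 2) + r.+1)%N.
  have := sqrn_bin2 r.+1; have := bin2D r.+1 (n - r.+1); rewrite subnKC // => ->.
  by have := subnKC ltrn; set m := (n - r.+1)%N; nia.
have qr : q ^+ r.+1 = (- z) ^+ r.+1 * (- w) ^+ r.+1 by rewrite -exprMn mulrNN zw.
rewrite (exprD _ _ r.+1) qr !(exprD q); ring.
Qed.

End BaileyKernel.

(** * Congruences modulo powers of q *)

Section Congruence.
Variable R : comUnitRingType.
Implicit Types (a p x y z : fps R) (m n r M L : nat).

Definition fps_eqmod M x y := forall n, (n < M)%N -> x n = y n.

Lemma fps_eqmod_refl M x : fps_eqmod M x x. Proof. by []. Qed.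

Lemma fps_eqmod_sym M x y : fps_eqmod M x y -> fps_eqmod M y x.
Proof. by move=> exy n /exy. Qed.

Lemma fps_eqmod_trans M y x z :
  fps_eqmod M x y -> fps_eqmod M y z -> fps_eqmod M x z.
Proof. by move=> exy eyz n ltnM; rewrite exy ?eyz. Qed.

Lemma fps_eqmodB M x y x' y' :
  fps_eqmod M x x' -> fps_eqmod M y y' -> fps_eqmod M (x - y) (x' - y').
Proof. by move=> ex ey n ltnM; rewrite !coefD_fps !coefN_fps ex ?ey. Qed.

Lemma fps_eqmodM M x y x' y' :
  fps_eqmod M x x' -> fps_eqmod M y y' -> fps_eqmod M (x * y) (x' * y').
Proof.
move=> ex ey n ltnM; rewrite !coefM_fps; apply: eq_bigr => i _.
by rewrite ex ?ey // (leq_ltn_trans _ ltnM) ?leq_subr // -ltnS.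
Qed.

Lemma fps_eqmod0M M x y : fps_eqmod M x 0 -> fps_eqmod M (x * y) 0.
Proof.
by move=> ex; rewrite -[X in fps_eqmod _ _ X](mul0r y); apply: fps_eqmodM.
Qed.

Lemma coef_sum_fps (I : Type) (s : seq I) (P : pred I) (F : I -> fps R) n :
  (\sum_(i <- s | P i) F i) n = \sum_(i <- s | P i) F i n.
Proof.
by apply: (big_morph (fun x => fps_coef x n)) => // x y; rewrite coefD_fps.
Qed.

Lemma fps_eqmod_sum M (I : Type) (s : seq I) (P : pred I) (F G : I -> fps R) :
  (forall i, P i -> fps_eqmod M (F i) (G i)) ->
  fps_eqmod M (\sum_(i <- s | P i) F i) (\sum_(i <- s | P i) G i).
Proof.
move=> eFG n ltnM; rewrite !coef_sum_fps; apply: eq_bigr => i Pi.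
exact: eFG.
Qed.

Lemma fps_eqmod_sum_trunc M L (F : nat -> fps R) : (M <= L)%N ->
  (forall n, (M <= n < L)%N -> fps_eqmod M (F n) 0) ->
  fps_eqmod M (\sum_(n < L) F n) (\sum_(n < M) F n).
Proof.
move=> leML F0 m ltmM; rewrite !coef_sum_fps.
rewrite -!(big_mkord xpredT (fun n => F n m)) (big_cat_nat _ leML) //=.
rewrite [X in _ + X = _](_ : _ = 0) ?addr0 // big_nat big1 // => n /F0; exact.
Qed.

Lemma fps_eqmodV M x y : x \is a GRing.unit -> y \is a GRing.unit ->
  fps_eqmod M x y -> fps_eqmod M x^-1 y^-1.
Proof.
move=> ux uy exy; rewrite -[x^-1](mulrK uy) -[X in fps_eqmod _ _ X](mulKr ux) mulrA.
by apply: fps_eqmodM => //; apply: fps_eqmodM => //; apply: fps_eqmod_sym.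
Qed.

Lemma fps_eqmod_expr0 M p m : p 0%N = 0 -> (M <= m)%N -> fps_eqmod M (p ^+ m) 0.
Proof. by move=> p0 leMm n ltnM; rewrite coef_expr_fps // (leq_trans ltnM). Qed.

(** Every factor 1 - a p^j with j >= M is 1 modulo q^M, because [p] has no constant term. *)
Lemma qpochinf_eqmod M a p m : p 0%N = 0 -> (M <= m)%N ->
  fps_eqmod M (qprod a p m) (qpochinf a p).
Proof.
move=> p0 leMm n ltnM; have [m0 cv] := qpochinf_cvg a p0 n.
have e d : fps_eqmod M (qprod a p (m + d)) (qprod a p m).
  elim: d => [|d IHd]; first by rewrite addn0.
  rewrite addnS qprodS; apply: fps_eqmod_trans IHd.
  rewrite -[X in fps_eqmod _ _ X]mulr1 -[X in fps_eqmod _ _ (_ * X)]subr0.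
  apply: fps_eqmodM => //; apply: fps_eqmodB => //; rewrite mulrC.
  by apply/fps_eqmod0M/fps_eqmod_expr0; rewrite // (leq_trans leMm) ?leq_addr.
by rewrite -(e m0) // -(cv (m + m0)%N) ?leq_addl.
Qed.

Lemma fps_unit1BX p m : p 0%N = 0 -> 1 - p ^+ m.+1 \is a GRing.unit.
Proof.
move=> p0; apply: fps_unit_coef0.
by rewrite coefD_fps coefN_fps coef_expr_fps // subr0 coef1_fps unitr1.
Qed.

Lemma bailey_ker_eqmod M p r n :
  p 0%N = 0 -> (r <= M)%N -> (2 * M <= n)%N ->
  fps_eqmod M (bailey_ker p r n) (qpochinf p p * qpochinf p p)^-1.
Proof.
move=> p0 lerM le2Mn; rewrite /bailey_ker (_ : (r <= n)%N = true); last by lia.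
have u1 m : 1 - p ^+ m.+1 \is a GRing.unit by apply: fps_unit1BX.
apply: fps_eqmodV; rewrite ?unitrM ?qfact_unit ?qpochinf_unit //.
by apply: fps_eqmodM; apply: qpochinf_eqmod => //; lia.
Qed.

(** For r < M both kernels have the same limit modulo q^M. The base [p] is left free: it is q for
    the Bailey chain and q^(2k) for the triple product. *)
Lemma sum_bailey_ker_eqmod M p L n (e a b : nat -> fps R) :
  p 0%N = 0 -> (M <= L)%N -> (2 * M <= n)%N ->
  (forall r, (M <= r)%N -> fps_eqmod M (a r) 0) ->
  (forall r, (M <= r)%N -> fps_eqmod M (b r) 0) ->
  fps_eqmod M
    (\sum_(r < L) e r * (a r * bailey_ker p r n - b r * bailey_ker p r.+1 n))
    ((\sum_(r < M) e r * (a r - b r)) / (qpochinf p p * qpochinf p p)).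
Proof.
move=> p0 leML le2Mn a0 b0.
pose F r := e r * (a r * bailey_ker p r n - b r * bailey_ker p r.+1 n).
apply: fps_eqmod_trans (_ : fps_eqmod M (\sum_(r < M) F r) _).
  apply: (fps_eqmod_sum_trunc (F := F)) => // r /andP[leMr _].
  rewrite /F mulrC; apply: fps_eqmod0M; rewrite -[0]subr0.
  by apply: fps_eqmodB; apply: fps_eqmod0M; [apply: a0 | apply: b0].
rewrite mulr_suml; apply: fps_eqmod_sum => r _; have := ltn_ord r.
rewrite -mulrA mulrBl => ltrM; apply: fps_eqmodM => //.
by apply: fps_eqmodB; apply: fps_eqmodM => //; apply: bailey_ker_eqmod => //; lia.
Qed.

Lemma lreg_fps_q : GRing.lreg (fps_q : fps R).
Proof.
move=> x y exy; apply: fpsP => n.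
by rewrite -(coef_mul_q x n.+1) mulrC exy mulrC coef_mul_q.
Qed.

(* The bilateral series sum_r (-1)^r q^(k r^2 + (k-i) r), with the terms r and
   - r - 1 paired and cut at r < M. *)
Definition theta_trunc k i M : fps R :=
  \sum_(r < M) (-1) ^+ r * (fps_q ^+ (k * r ^ 2 + (k - i) * r)
                            - fps_q ^+ (k * r.+1 ^ 2 - (k - i) * r.+1)).

Lemma theta_exponents_ge k i r : (0 < i <= k)%N ->
  (r <= k * r ^ 2 + (k - i) * r)%N /\ (r <= k * r.+1 ^ 2 - (k - i) * r.+1)%N.
Proof.
case/andP=> i_gt0 leik; split; first by nia.
by rewrite -mulnn mulnA -mulnBl; nia.
Qed.

Lemma jacobi_triple_eqmod M k i : (0 < i <= k)%N ->
  fps_eqmod M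
    (qpochinfs [:: fps_q ^+ i; fps_q ^+ (2 * k - i); fps_q ^+ (2 * k)]
       (fps_q ^+ (2 * k)))
    (theta_trunc k i M).
Proof.
move=> hi; have /andP[i_gt0 leik] := hi.
set p := fps_q ^+ (2 * k); set z := fps_q ^+ (2 * k - i); set w := fps_q ^+ i.
have p0 : p 0%N = 0 by rewrite coef_expr_fps //; lia.
have u1 m : 1 - p ^+ m.+1 \is a GRing.unit by apply: fps_unit1BX.
have uQ : qpochinf p p \is a GRing.unit by apply: qpochinf_unit.
have zw : z * w = p by rewrite -exprD subnK //; lia.
have [regp regz] : GRing.lreg p /\ GRing.lreg z.
  by split; apply: lregX; apply: lreg_fps_q.
rewrite /qpochinfs !big_cons big_nil mulr1 mulrCA mulrA.
(* Twice M, so that n - r >= M for every kernel index r <= M. *)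
pose n := (2 * M)%N.
apply: (@fps_eqmod_trans _ (qprod z p n * qprod w p n * qpochinf p p)).
  apply: fps_eqmod_sym; apply: fps_eqmodM => //.
  by apply: fps_eqmodM; apply: qpochinf_eqmod => //; rewrite /n; lia.
rewrite (jacobi_triple_finite u1 n regp regz zw).
apply: (@fps_eqmod_trans _ (qpochinf p p
    * (theta_trunc k i M / (qpochinf p p * qpochinf p p)) * qpochinf p p)).
  apply: fps_eqmodM => //; apply: fps_eqmodM.
    by apply: qpochinf_eqmod => //; rewrite /n; lia.
  rewrite (eq_bigr (fun r : 'I_n.+1 => (-1) ^+ r *
     (fps_q ^+ (k * r ^ 2 + (k - i) * r) * bailey_ker p r n
      - fps_q ^+ (k * r.+1 ^ 2 - (k - i) * r.+1) * bailey_ker p r.+1 n))).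
    apply: (sum_bailey_ker_eqmod (fun r => (-1) ^+ r)
      (a := fun r => fps_q ^+ (k * r ^ 2 + (k - i) * r))
      (b := fun r => fps_q ^+ (k * r.+1 ^ 2 - (k - i) * r.+1))) => //.
    - by rewrite /n; lia.
    - move=> r leMr; apply: fps_eqmod_expr0 => //; apply: leq_trans leMr _.
      by have [] := theta_exponents_ge r hi.
    - move=> r leMr; apply: fps_eqmod_expr0 => //; apply: leq_trans leMr _.
      by have [] := theta_exponents_ge r hi.
  (* The exponents agree by (2k-i) r + 2k 'C(r, 2) = k r^2 + (k-i) r and i s + 2k 'C(s, 2) = k s^2 -
     (k-i) s for s = r + 1. *)
  move=> r _; rewrite -!exprM -!exprD; congr (_ * (fps_q ^+ _ * _ - fps_q ^+ _ * _)).
    by have := sqrn_bin2 r; rewrite -(subnKC leik); set j := (k - i)%N; nia.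
  apply/esym; apply: (canLR (addnK _)) => /=; have := sqrn_bin2 r.+1.
  by rewrite -(subnKC leik) addKn; set j := (k - i)%N; nia.
have -> : qpochinf p p * (theta_trunc k i M / (qpochinf p p * qpochinf p p))
          * qpochinf p p = theta_trunc k i M; last exact: fps_eqmod_refl.
by rewrite mulrC mulrCA mulrA mulrC divrK // unitrM uQ.
Qed.

End Congruence.

(** * Nested sums over chains *)

Section ChainSums.
Variables (R : comNzRingType) (K : nat -> nat -> nat -> R).
Implicit Types (r n m l M : nat) (s : seq nat).

Fixpoint chain_weight r n s : R :=
  if s is m :: s' then K r n m * chain_weight r.+1 m s' else K r n 0%N.

(** No order is imposed on the parts; the kernel used below vanishes where the order fails. The
    closing factor has N_k = 0. *)
Fixpoint chain_sum M l r n : R :=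
  if l is l'.+1 then \sum_(m < M) K r n m * chain_sum M l' r.+1 m
  else K r n 0%N.

Lemma chain_sumS M l r n :
  chain_sum M l.+1 r n = \sum_(m < M) K r n m * chain_sum M l r.+1 m.
Proof. by []. Qed.

Lemma big_tuple_cons (T : finType) l (F : l.+1.-tuple T -> R) :
  \sum_(t : l.+1.-tuple T) F t
  = \sum_(x : T) \sum_(t : l.-tuple T) F [tuple of x :: t].
Proof.
rewrite pair_bigA (reindex (fun u : T * l.-tuple T => [tuple of u.1 :: u.2])) //.
exists (fun t => (thead t, [tuple of behead t])) => [[x t]|t] _ /=.
  by rewrite theadE; congr (_, _); apply: val_inj.
by rewrite -tuple_eta.
Qed.

Lemma sum_chain_weight M l r n :
  \sum_(t : l.-tuple 'I_M) chain_weight r n (map val t) = chain_sum M l r n.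
Proof.
elim: l r n => [|l IHl] r n.
  by rewrite (big_pred1 [tuple]) // => t; rewrite [t]tuple0 /= eqxx.
rewrite big_tuple_cons; apply: eq_bigr => m _ /=.
by rewrite -mulr_sumr IHl.
Qed.

Lemma chain_weightE r n s :
  chain_weight r n s
  = \prod_(a < (size s).+1) K (r + a) (nth 0%N (n :: s) a) (nth 0%N s a).
Proof.
elim: s r n => [|m s IHs] r n; first by rewrite big_ord1 addn0.
rewrite big_ord_recl /= addn0 IHs; congr (_ * _).
by apply: eq_bigr => a _ /=; rewrite /bump /= add1n addnS.
Qed.

End ChainSums.

Lemma finite_set_seq (T : choiceType) (s : seq T) (A : set T) :
  (forall x, A x -> x \in s) -> finite_set A.
Proof.
move=> sub; apply: (@sub_finite_set _ _ [set` s]%classic) => //.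
Qed.

Lemma fps_sum_seq (R : comNzRingType) (I : choiceType) (A : set I)
    (F : I -> fps R) (s : seq I) n :
  uniq s -> (forall x, x \in s -> A x) ->
  (forall x, A x -> F x n != 0 -> x \in s) ->
  fps_sum A F n = \sum_(x <- s) F x n.
Proof.
move=> us sA As; rewrite /fps_sum /= (fsbigE s) //.
  rewrite big_seq_cond [RHS]big_seq_cond; apply: eq_bigl => x.
  by rewrite andbT; case: (boolP (x \in s)) => // /sA Ax; rewrite (mem_set Ax).
by move=> x Ax; apply: contraNeq; apply: As.
Qed.

(** * The summand as a product of kernels along a chain *)

Local Notation q := (fps_q : fps rat).
Local Notation qfact := (qprod q q).

Definition qpoch_pred m : fps rat := qpoch (- q) (m%:Z - 1).

Lemma qpoch_pred0 : qpoch_pred 0 * 2 = 1.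
Proof.
rewrite /qpoch_pred sub0r qpoch_Nq_N1 // mulVr //.
exact: fps_unit_coef0.
Qed.

Lemma qpoch_predS n : qpoch_pred n.+1 = qprod (- q) q n.
Proof. by rewrite /qpoch_pred -addn1 PoszD addrK qpoch_nat // coefN_fps oppr0. Qed.

Lemma unit1Bq n : 1 - q ^+ n.+1 \is a GRing.unit.
Proof. exact: fps_unit1BX. Qed.

(* The factor of the summand contributed by N_(r-1) = n and N_r = m; for r = 1
   it does not depend on n, and r = k, m = N_k = 0 gives 1 / (q)_(N_(k-1)),
   doubled when i = k. *)
Definition chain_kernel i r n m : fps rat :=
  (if r == 1%N then q ^+ 'C(m.+1, 2) * qpoch_pred m
   else if (m <= n)%N then q ^+ (m ^ 2) / qfact (n - m) else 0)
  * q ^+ (if (i < r)%N then m else 0%N)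
  * (if r == i then 1 + q ^+ m else 1).

Lemma eq_bailey_step (f g : nat -> fps rat) n :
  (forall m, (m <= n)%N -> f m = g m) -> bailey_step q f n = bailey_step q g n.
Proof. by move=> efg; apply: eq_bigr => m _; rewrite efg // -ltnS. Qed.

Lemma sum_chain_kernel M i r n (f : nat -> fps rat) : (1 < r)%N -> (n < M)%N ->
  \sum_(m < M) chain_kernel i r n m * f m =
  bailey_step q (fun m => q ^+ (if (i < r)%N then m else 0%N)
    * ((if r == i then 1 + q ^+ m else 1) * f m)) n.
Proof.
move=> lt1r ltnM; rewrite /bailey_step.
rewrite (big_ord_widen M (fun m => q ^+ (m ^ 2) / qfact (n - m)
  * (q ^+ (if (i < r)%N then m else 0%N)
     * ((if r == i then 1 + q ^+ m else 1) * f m)))) //.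
rewrite [RHS]big_mkcond; apply: eq_bigr => m _; rewrite /chain_kernel.
rewrite (gtn_eqF lt1r) ltnS; case: ifP => _; last by rewrite !mul0r.
by rewrite !mulrA.
Qed.

Lemma chain_sum_kernel M k i l r n :
  (0 < i <= k)%N -> (1 < r)%N -> (r + l)%N = k -> (n < M)%N ->
  chain_sum (chain_kernel i) M l r n =
  if (i < r)%N then
    iter l.+1 (fun f => bailey_step q (fun n => q ^+ n * f n))
      (fun n => (n == 0%N)%:R) n
  else bailey_iter q (i - r).+1 (k - i) n.
Proof.
move=> /andP[i_gt0 leik]; elim: l r n => [|l IHl] r n lt1r def_k ltnM.
  (* The closing factor at N_k = 0 is written as a sum against the delta function, so that it
     becomes a Bailey step too. *)
  have -> : chain_sum (chain_kernel i) M 0 r n =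
            \sum_(m < M) chain_kernel i r n m * (m == 0%N :> nat)%:R.
    case: M ltnM => // M _; rewrite big_ord_recl mulr1 big1 ?addr0 // => m _.
    by rewrite mulr0.
  rewrite (sum_chain_kernel _ (fun m => (m == 0%N)%:R)) //.
  have [ltir|leri] := ltnP i r.
    by apply: eq_bailey_step => m _; rewrite (gtn_eqF ltir) mul1r.
  have -> : r = i by lia.
  rewrite subnn eqxx (_ : (k - i = 0)%N); last by lia.
  by apply: eq_bailey_step => m _; rewrite mul1r.
rewrite chain_sumS (sum_chain_kernel _ (chain_sum (chain_kernel i) M l r.+1)) //.
have ltmM m : (m <= n)%N -> (m < M)%N by lia.
have [ltir|leri] := ltnP i r.
  rewrite iterS; apply: eq_bailey_step => m lemn.
  by rewrite (gtn_eqF ltir) mul1r (IHl _ _ (leqW lt1r)) ?ltmM ?leqW //; lia.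
have [eri|neri] := eqVneq r i.
  subst i; rewrite subnn; apply: eq_bailey_step => m lemn; rewrite expr0 mul1r.
  rewrite (IHl _ _ (leqW lt1r)) ?ltmM ?ltnSn //; last by rewrite addSnnS.
  by have -> : (k - r = l.+1)%N by lia.
have -> : (i - r = (i - r.+1).+1)%N by lia.
rewrite [RHS]/bailey_iter iterS; apply: eq_bailey_step => m lemn.
rewrite !mul1r (IHl _ _ (leqW lt1r)) ?ltmM //; last by lia.
by rewrite ltnS leqNgt ltn_neqAle neri leri.
Qed.

Lemma chain_sum_kernel1 M k i : (2 <= k)%N -> (0 < i <= k)%N ->
  chain_sum (chain_kernel i) M k.-1 1 0
  = \sum_(m < M) q ^+ 'C(m.+1, 2) * qpoch_pred m * bailey_iter q i.-1 (k - i) m.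
Proof.
case: k => [|[|l]] // _ hi; have /andP[i_gt0 leik] := hi.
rewrite [l.+2.-1]/= chain_sumS.
apply: eq_bigr => m _; rewrite [chain_kernel i 1 0 m]/chain_kernel eqxx.
rewrite (_ : (i < 1)%N = false) ?expr0 ?mulr1; last by lia.
rewrite -(mulrA (_ * qpoch_pred m)) (chain_sum_kernel hi) ?ltn_ord //; congr (_ * _).
(* For i = 1 the factor 1 + q^(N_1) is the outermost one of [bailey_iter], which then has no further
   steps. *)
have [e1i|ne1i] := eqVneq 1%N i; first by subst i.
have -> : (i < 2)%N = false by lia.
by rewrite mul1r; congr (bailey_iter _ _ _ _); lia.
Qed.

(** The sum over N_1 with the extra factor 1 / (q)_(N-N_1), at N = 2M, is evaluated twice modulo
    q^M: as the wanted sum over (q)_oo, and by [bailey_iter_final]. *)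
Lemma chain_sum_eqmod M k i : (2 <= k)%N -> (0 < i <= k)%N ->
  fps_eqmod M (chain_sum (chain_kernel i) M k.-1 1 0)
    (qpochinf (- q) q
    * qpochinfs [:: q ^+ i; q ^+ (2 * k - i); q ^+ (2 * k)] (q ^+ (2 * k))
    / qpochinf q q).
Proof.
move=> hk hi; rewrite chain_sum_kernel1 //.
set Q := qpochinf q q; have uQ : Q \is a GRing.unit by apply: qpochinf_unit.
pose P n := q ^+ 'C(n.+1, 2) * qpoch_pred n.
pose N := (2 * M)%N.
have trunc : fps_eqmod M
    (\sum_(n < N.+1) P n / qfact (N - n) * bailey_iter q i.-1 (k - i) n)
    ((\sum_(n < M) P n * bailey_iter q i.-1 (k - i) n) / Q).
  pose F n := P n / qfact (N - n) * bailey_iter q i.-1 (k - i) n.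
  apply: (@fps_eqmod_trans _ M (\sum_(n < M) F n)).
    apply: (fps_eqmod_sum_trunc (F := F)); first by rewrite /N; lia.
    move=> n /andP[leMn _]; rewrite /F /P -!mulrA; apply: fps_eqmod0M.
    apply: fps_eqmod_expr0 => //; apply: leq_trans leMn _.
    by rewrite binS bin1 leq_addl.
  rewrite mulr_suml; apply: fps_eqmod_sum => n _; rewrite /F mulrAC.
  apply: fps_eqmodM => //; apply: fps_eqmodV => //.
    exact: qfact_unit unit1Bq _.
  by apply: qpochinf_eqmod => //; rewrite /N; have := ltn_ord n; lia.
have final : fps_eqmod M
    (\sum_(n < N.+1) P n / qfact (N - n) * bailey_iter q i.-1 (k - i) n)
    (qpochinf (- q) q * (theta_trunc rat k i M / (Q * Q))).
  rewrite (bailey_iter_final unit1Bq N hi qpoch_pred0 qpoch_predS).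
  apply: fps_eqmodM; first by apply: qpochinf_eqmod; rewrite // /N; lia.
  apply: (sum_bailey_ker_eqmod (fun r => (-1) ^+ r)
      (a := fun r => q ^+ (k * r ^ 2 + (k - i) * r))
      (b := fun r => q ^+ (k * r.+1 ^ 2 - (k - i) * r.+1))) => //.
  - by rewrite /N; lia.
  - move=> r leMr; apply: fps_eqmod_expr0 => //; apply: leq_trans leMr _.
    by have [] := theta_exponents_ge r hi.
  - move=> r leMr; apply: fps_eqmod_expr0 => //; apply: leq_trans leMr _.
    by have [] := theta_exponents_ge r hi.
rewrite -[X in fps_eqmod _ X](divrK uQ).
apply: (@fps_eqmod_trans _ M
  (qpochinf (- q) q * (theta_trunc rat k i M / (Q * Q)) * Q)).
  apply: fps_eqmodM => //.
  exact: fps_eqmod_trans (fps_eqmod_sym trunc) final.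
have -> : qpochinf (- q) q * (theta_trunc rat k i M / (Q * Q)) * Q
          = qpochinf (- q) q * theta_trunc rat k i M / Q.
  by rewrite invrM // !mulrA divrK.
apply: fps_eqmodM => //; apply: fps_eqmodM => //.
exact: fps_eqmod_sym (jacobi_triple_eqmod _ hi).
Qed.

(** The position r = 1 is excluded because its predecessor [n] is a dummy and the kernel does not
    compare with it. *)
Lemma chain_weight_unsorted i r n s : (1 < r)%N -> ~~ path geq n s ->
  chain_weight (chain_kernel i) r n s = 0.
Proof.
elim: s r n => //= m s IHs r n lt1r; rewrite negb_and => /orP[ltnm|nsorted].
  by rewrite /chain_kernel (gtn_eqF lt1r) (negbTE ltnm) !mul0r.
by rewrite IHs ?mulr0 // leqW.
Qed.

Lemma summandE k i (N : k.-1.-tuple nat) : (2 <= k)%N -> (0 < i <= k)%N ->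
  sorted geq N ->
  summand k i N = chain_weight (chain_kernel i) 1 0 N.
Proof.
case: k N => [|[|l]] // N _ /andP[i_gt0 leik] sN.
have szN : size N = l.+1 by rewrite size_tuple.
have nth_out a : (l < a)%N -> nth 0%N N a = 0%N.
  by move=> lt; rewrite nth_default ?szN.
have nth_dec a : (nth 0%N N a.+1 <= nth 0%N N a)%N.
  have [lt|le] := ltnP a.+1 l.+1; last by rewrite nth_out.
  by have /(sortedP 0%N)/(_ a) := sN; rewrite szN; apply.
have qpochE (n : nat) : qpoch q n = qfact n by rewrite qpoch_nat.
(* The three factors of [chain_kernel] are multiplied up separately; the index a stands for r = a +
   1. *)
rewrite chain_weightE szN !big_split /=.
set A := \prod_(a < l.+2) (if _ then _ else _).
have -> : \prod_(a < l.+2) (if (1 + a)%N == i then 1 + q ^+ nth 0%N N a else 1)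
          = 1 + q ^+ part N i.
  rewrite -big_mkcond /= (big_pred1 (inord i.-1)) => [|a].
    by rewrite /part inordK //; lia.
  by rewrite /= -val_eqE /= inordK; [apply/eqP/eqP; lia | lia].
have -> : \prod_(a < l.+2) q ^+ (if (i < 1 + a)%N then nth 0%N N a else 0%N)
          = q ^+ \sum_(i.+1 <= r < l.+2) part N r.
  rewrite big_ord_recr /= nth_out // if_same mulr1.
  rewrite (big_morph (fun n => q ^+ n) (exprD q) (erefl : q ^+ 0 = 1)).
  rewrite big_add1 big_geq_mkord [RHS]big_mkcond; apply: eq_bigr => a _ /=.
  by rewrite add1n ltnS; case: ifP.
have -> : A = q ^+ ((part N 1 + 1) * part N 1 %/ 2) * qpoch_pred (part N 1)
    * q ^+ (\sum_(2 <= r < l.+2) part N r ^ 2)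
    / ((\prod_(1 <= r < l.+1) qpoch q ((part N r)%:Z - (part N r.+1)%:Z))
       * qpoch q (part N l.+1)).
  have -> : \prod_(1 <= r < l.+1) qpoch q ((part N r)%:Z - (part N r.+1)%:Z)
      * qpoch q (part N l.+1)
      = \prod_(a < l.+1) qfact (nth 0%N N a - nth 0%N N a.+1).
    rewrite big_ord_recr /= [nth _ N l.+1]nth_out // subn0 qpochE; congr (_ * _).
    rewrite big_add1 big_mkord; apply: eq_bigr => a _.
    by rewrite /part /= subzn ?nth_dec // qpochE.
  rewrite /A big_ord_recl /= -[RHS]mulrA; congr (_ * _ * _).
    by rewrite /part /= bin2 divn2 addn1.
  have -> : (\sum_(2 <= r < l.+2) part N r ^ 2 = \sum_(a < l.+1) nth 0 N a.+1 ^ 2)%N.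
    rewrite big_ord_recr /= [nth _ N l.+1]nth_out // addn0.
    by rewrite !big_add1 big_mkord.
  rewrite (big_morph (fun n => q ^+ n) (exprD q) (erefl : q ^+ 0 = 1)).
  rewrite -prodrV => [|a _]; last exact: qfact_unit unit1Bq _.
  rewrite -big_split; apply: eq_bigr => a _ /=.
  by rewrite /bump add1n add0n nth_dec.
rewrite /summand /exponent !exprD -/(qpoch_pred _) -!mulrA; congr (_ * _). ring.
Qed.

(** * Summability and reduction to bounded chains *)

Lemma exponent_ge k i (N : k.-1.-tuple nat) : (part N 1 <= exponent i N)%N.
Proof.
apply: leq_trans (leq_addr _ _); apply: leq_trans (leq_addr _ _).
by rewrite mulnC addn1 -[(_ * _)%N]/((part N 1).+1.-1 * (part N 1).+1)%N; nia.
Qed.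

(** Built from tuples over ['I_M], so that a sum over it becomes the finite sum of
    [sum_chain_weight]. *)
Definition bounded_chains k M : seq (k.-1.-tuple nat) :=
  [seq map_tuple val t | t : k.-1.-tuple 'I_M <-
     [seq t : k.-1.-tuple 'I_M <- index_enum {: k.-1.-tuple 'I_M}
        | sorted geq (map val t)]].

Lemma bounded_chains_uniq k M : uniq (bounded_chains k M).
Proof.
rewrite map_inj_uniq ?filter_uniq ?index_enum_uniq // => s t /(congr1 val) est.
by apply/val_inj/(inj_map val_inj).
Qed.

Lemma mem_bounded_chains k M (N : k.-1.-tuple nat) :
  (N \in bounded_chains k M.+1) = sorted geq N && all (leq^~ M) N.
Proof.
apply/mapP/andP => [[t]|[sN leM]].
  rewrite mem_filter => /andP[st _] ->; split=> //.
  by apply/allP => _ /mapP[x _ ->]; rewrite /= -ltnS.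
have eN : map val (map (@inord M) N) = N.
  rewrite -map_comp map_id_in // => n /(allP leM) lenM /=.
  by rewrite inordK.
exists (map_tuple (@inord M) N); last by apply: val_inj; rewrite /= eN.
by rewrite mem_filter mem_index_enum andbT /= eN.
Qed.

Lemma mem_bounded_chains_coef k i (N : k.-1.-tuple nat) n :
  (2 <= k)%N -> sorted geq N -> summand k i N n != 0 ->
  N \in bounded_chains k n.+1.
Proof.
move=> hk sN Nn0; rewrite mem_bounded_chains sN /=.
(* The summand is divisible by q^(N_1), so a nonzero coefficient at n bounds N_1, the largest
   part. *)
have leN1n : (part N 1 <= n)%N.
  apply: leq_trans (exponent_ge i N) _; rewrite leqNgt; apply: contra Nn0 => lt.
  apply/eqP; rewrite /summand -!mulrA.
  apply: (@fps_eqmod0M _ n.+1) (ltnSn n); exact: fps_eqmod_expr0.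
move: N sN leN1n {Nn0} => [[|m s] sz] /= path_s lemn //.
rewrite lemn; apply/allP => x sx; apply: leq_trans lemn.
apply: (allP (order_path_min _ path_s)) => // y1 y2 y3 /= le12 le31.
exact: leq_trans le12.
Qed.

Unset Implicit Arguments.

Theorem theorem1p8 (k i : nat) (hk : (2 <= k)%N) (hi : (1 <= i <= k)%N) :
  fps_summable (chains k) (summand k i) /\
  fps_sum (chains k) (summand k i) =
    qpochinf (- fps_q) fps_q
    * qpochinfs [:: fps_q ^+ i; fps_q ^+ (2 * k - i); fps_q ^+ (2 * k)]
        (fps_q ^+ (2 * k))
    / qpochinf fps_q fps_q.
Proof.
split=> [n|].
  apply: (@finite_set_seq _ (bounded_chains k n.+1)) => N [].
  exact: mem_bounded_chains_coef.
(* Coefficient n is read modulo q^(n+1), which leaves only chains with parts at most n. *)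
apply: fpsP => n; rewrite -(chain_sum_eqmod hk hi (ltnSn n)).
rewrite (@fps_sum_seq _ _ _ _ (bounded_chains k n.+1)).
- rewrite big_map big_filter -coef_sum_fps -sum_chain_weight; congr (fps_coef _ n).
  (* The nested sum also runs over tuples that are not weakly decreasing; these contribute 0. *)
  rewrite big_mkcond; apply: eq_bigr => t _.
  case: ifPn => st; first by rewrite summandE.
  case: (map val t) st => //= m s st.
  by rewrite chain_weight_unsorted ?mulr0.
- exact: bounded_chains_uniq.
- by move=> N; rewrite mem_bounded_chains => /andP[].
- by move=> N; apply: mem_bounded_chains_coef.
Qed.
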